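(* Consider the SdLBFGS-VR algorithm described in the context for minimizing $f(x)=\frac1T\sum_{i=1}^Tf_i(x)$, and suppose assumptions AS.1, AS.2 and AS.5 (stated in the context) hold. Set $\beta_t=\beta=\frac{L\bar{\kappa}}{T^{1/3}}$ and $c_q^{k+1}=c_q=0$. Suppose that there exist constants $\nu,\mu_0\in(0,1)$ such that $$\left(1-\frac{\nu\bar{\kappa}}{\mu_0\underline{\kappa}}\right)\underline{\kappa}\ge\mu_0\bar{\kappa}(e-1)+\mu_0m\bar{\kappa}+2\mu_0^2\bar{\kappa}m(e-1),$$ and set $\alpha_t^{k+1}=\alpha=\frac{\mu_0m}{L\bar{\kappa}T^{2/3}}$ for all $t,k$, and $q=\left\lfloor\frac{T}{3\mu_0m}\right\rfloor$. Then, to achieve $\mathbb{E}[\|\nabla f(x)\|^2]\le\epsilon$ for the output $x$ of the algorithm, the total number of component gradient evaluations required is $O\left(T^{2/3}/\epsilon\right)$.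
   Context: Problem. $f(x)=\frac1T\sum_{i=1}^Tf_i(x)$ with $f_i:\mathbb{R}^n\to\mathbb{R}$; $[T]=\{1,\ldots,T\}$; for $\mathcal{K}\subseteq[T]$ with $|\mathcal{K}|=m$, $\nabla f_{\mathcal{K}}(x)=\frac1m\sum_{i\in\mathcal{K}}\nabla f_i(x)$. $\|\cdot\|$ is the Euclidean norm (operator norm for matrices); $e$ is Euler's number; $A\preceq B$ means $B-A$ is positive semidefinite. SdLBFGS-VR. Input $\tilde x_0\in\mathbb{R}^n$, step sizes $\alpha_t^{k+1}>0$, batch size $m$, inner length $q$, number $N$ of outer iterations. For $k=0,\ldots,N-1$: set $x_0^{k+1}=\tilde x_k$ and compute $\nabla f(\tilde x_k)$; for $t=0,\ldots,q-1$: draw a random sample set $\mathcal{K}\subseteq[T]$ with $|\mathcal{K}|=m$, set $g_t^{k+1}=\nabla f_{\mathcal{K}}(x_t^{k+1})-\nabla f_{\mathcal{K}}(\tilde x_k)+\nabla f(\tilde x_k)$ and $x_{t+1}^{k+1}=x_t^{k+1}-\alpha_t^{k+1}H_t^{k+1}g_t^{k+1}$; then set $\tilde x_{k+1}=x_q^{k+1}$. Output: $x$ chosen uniformly at random from $\{x_t^{k+1}:t=0,\ldots,q-1;\ k=0,\ldots,N-1\}$. Component gradient evaluations are evaluations of individual $\nabla f_i$: $T$ for each full gradient $\nabla f(\tilde x_k)$ and a number proportional to $m$ for each inner iteration, so of order $(T+qm)N$ in total. The matrices $H_t^{k+1}$ are produced by the stochastic damped L-BFGS formula with memory size $p$. Number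 the successive steps of the algorithm linearly and write $x_j$ for the iterate at step $j$ and $\mathcal{K}_j$ for its sample set. With $s_{j-1}=x_j-x_{j-1}$, $y_{j-1}=\nabla f_{\mathcal{K}_{j-1}}(x_j)-\nabla f_{\mathcal{K}_{j-1}}(x_{j-1})$, let $\gamma_j=\max\{y_{j-1}^\top y_{j-1}/(s_{j-1}^\top y_{j-1}),\delta\}$ ($\delta>0$ fixed), $H_{j,0}=\gamma_j^{-1}I$, $\bar y_{j-1}=\theta_{j-1}y_{j-1}+(1-\theta_{j-1})\gamma_js_{j-1}$, where $\theta_{j-1}=\frac{0.75\gamma_j\|s_{j-1}\|^2}{\gamma_j\|s_{j-1}\|^2-s_{j-1}^\top y_{j-1}}$ if $s_{j-1}^\top y_{j-1}<0.25\gamma_j\|s_{j-1}\|^2$ and $\theta_{j-1}=1$ otherwise; the matrix at step $j$ is obtained from $H_{j,0}$ by applying successively, for the $p$ most recent pairs $(s_l,\bar y_l)$ (all available ones if fewer), oldest first, the update $H\mapsto(I-\rho_ls_l\bar y_l^\top)H(I-\rho_l\bar y_ls_l^\top)+\rho_ls_ls_l^\top$, $\rho_l=(s_l^\top\bar y_l)^{-1}$. So each $H_t^{k+1}$ depends only on samples drawn before step $(k+1,t)$. $\underline{\kappa},\bar{\kappa}>0$ are constants with $\underline{\kappa}I\preceq H_t^{k+1}\preceq\bar{\kappa}I$ for all $t,k$ (the paper derives such bounds from AS.5). Assumptions. AS.1: $f$ is continuously differentiable, bounded below, and $\|\nabla f(x)-\nabla f(y)\|\le L\|x-y\|$ for all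 $x,y\in\mathbb{R}^n$. AS.2: the sample gradients $\nabla f_i$ ($i$ uniform in $[T]$) satisfy, at every iterate $x$, $\mathbb{E}_i[\nabla f_i(x)]=\nabla f(x)$ and $\mathbb{E}_i[\|\nabla f_i(x)-\nabla f(x)\|^2]\le\sigma^2$; samples drawn at different steps are independent and independent of the current and past iterates. AS.5: each $f_i$ is twice continuously differentiable and $\|\nabla^2f_i(x)\|\le\kappa$ for all $x$ and $i$. The auxiliary numbers are $c_t^{k+1}=c_{t+1}^{k+1}\left(1+\alpha_t^{k+1}\beta_t+2L^2(\alpha_t^{k+1})^2\bar{\kappa}^2/m\right)+(\alpha_t^{k+1})^2L^3\bar{\kappa}^2/m$, starting from $c_q^{k+1}$. The $O(\cdot)$ is in terms of $T$ and $\epsilon$; the other problem constants ($L$, $\nu$, $\mu_0$, $m$, $\underline{\kappa}$, $\bar{\kappa}$ and the initial gap $f(\tilde x_0)-\min f$) are treated as fixed.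
   Formalization: Added: the sample gradients are L-Lipschitz in mean square, (1/T)∑‖∇f_i(x)−∇f_i(y)‖² ≤ L²‖x−y‖² (false without it); and the O(T^{2/3}/ε) bound is claimed unless one outer iteration, costing at least T evaluations, already suffices. *)

(* Defs.v *)
From HB Require Import structures.
From mathcomp Require Import all_boot all_order all_algebra.
From mathcomp Require Import all_classical all_reals all_analysis.
Set Implicit Arguments.
Unset Strict Implicit.
Unset Printing Implicit Defensive.
Import Order.TTheory GRing.Theory Num.Theory.
Import numFieldNormedType.Exports.
Local Open Scope classical_set_scope.
Local Open Scope ring_scope.

Section euclidean.
Context {R : realType}.

Definition dot n (u v : 'cV[R]_n) : R := (u^T *m v) 0 0.

(* MathComp-Analysis equips matrices with the max norm; that norm is used
   below only for the topology (differentiability, continuity). *)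
Definition enorm n (u : 'cV[R]_n) : R := Num.sqrt (dot u u).

Definition opnorm n (A : 'M[R]_n) : R :=
  sup [set enorm (A *m v) | v in [set v : 'cV[R]_n | enorm v <= 1]].

Definition psd n (A : 'M[R]_n) : Prop :=
  A^T = A /\ forall v : 'cV[R]_n, 0 <= dot v (A *m v).

Definition loewner_le n (A B : 'M[R]_n) : Prop := psd (B - A).

Definition gradient n (f : 'cV[R]_n -> R) (x : 'cV[R]_n) : 'cV[R]_n :=
  \col_i 'D_(delta_mx i 0) f x.

Definition hessian n (f : 'cV[R]_n -> R) (x : 'cV[R]_n) : 'M[R]_n :=
  \matrix_(i, j) 'D_(delta_mx j 0) (fun y => gradient f y i 0) x.

Definition C1 n (f : 'cV[R]_n -> R) : Prop :=
  (forall x, differentiable f x) /\ continuous (gradient f).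

Definition C2 n (f : 'cV[R]_n -> R) : Prop :=
  [/\ C1 f, forall x, differentiable (gradient f) x & continuous (hessian f)].

End euclidean.

Section finite_sum.
Context {R : realType}.
Variables (T n : nat).
Implicit Types (f : 'I_T -> 'cV[R]_n -> R) (x : 'cV[R]_n).

Definition objective f x : R := T%:R^-1 * \sum_(i < T) f i x.

Definition batch_gradient f (K : {set 'I_T}) x : 'cV[R]_n :=
  #|K|%:R^-1 *: \sum_(i in K) gradient (f i) x.

Definition AS1 f (L : R) : Prop :=
  [/\ C1 (objective f),
      has_lbound (range (objective f))
    & forall x y, enorm (gradient (objective f) x - gradient (objective f) y)
                  <= L * enorm (x - y)].

(* The pointwise part of AS.2, for an index uniform in 'I_T. The independence
   part is [mutually_independent] below. *)
Definition AS2_at f (sigma : R) x : Prop :=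
  T%:R^-1 *: \sum_(i < T) gradient (f i) x = gradient (objective f) x /\
  T%:R^-1 * \sum_(i < T) enorm (gradient (f i) x - gradient (objective f) x) ^+ 2
    <= sigma ^+ 2.

Definition AS5 f (kappa : R) : Prop :=
  forall i, C2 (f i) /\ forall x, opnorm (hessian (f i) x) <= kappa.

(* The constant L of AS.1 must also control the sample gradients: the term
   2 L^2 alpha^2 kbar^2 / m in the recursion for c comes from
   E_i |grad f_i(x) - grad f_i(y)|^2 <= L^2 |x - y|^2, which does not follow
   from the L-smoothness of the average. It holds as soon as every
   gradient (f i) is L-Lipschitz, in particular if kappa <= L. *)
Definition sample_smooth f (L : R) : Prop :=
  forall x y,
    T%:R^-1 * \sum_(i < T) enorm (gradient (f i) x - gradient (f i) y) ^+ 2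
      <= L ^+ 2 * enorm (x - y) ^+ 2.

(* Variance-reduced gradient at x with snapshot xs. *)
Definition vr_gradient f (K : {set 'I_T}) x xs : 'cV[R]_n :=
  batch_gradient f K x - batch_gradient f K xs + gradient (objective f) xs.

End finite_sum.

Section damped_LBFGS.
Context {R : realType}.
Variable n : nat.
Implicit Types (s y : 'cV[R]_n) (H : 'M[R]_n).

(* gamma_{l+1}, from the pair (s_l, y_l). As r / 0 = 0, it is delta if
   dot s y = 0. *)
Definition bfgs_gamma (delta : R) s y : R :=
  Num.max (dot y y / dot s y) delta.

Definition bfgs_theta (delta : R) s y : R :=
  let gamma := bfgs_gamma delta s y in
  if dot s y < 4^-1 * gamma * enorm s ^+ 2
  then (3 / 4 * gamma * enorm s ^+ 2) / (gamma * enorm s ^+ 2 - dot s y)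
  else 1.

Definition damped_y (delta : R) s y : 'cV[R]_n :=
  let theta := bfgs_theta delta s y in
  theta *: y + ((1 - theta) * bfgs_gamma delta s y) *: s.

(* The identity if s = 0, since then rho = 0. *)
Definition bfgs_update H s yb : 'M[R]_n :=
  let rho := (dot s yb)^-1 in
  (1%:M - rho *: (s *m yb^T)) *m H *m (1%:M - rho *: (yb *m s^T))
  + rho *: (s *m s^T).

Section matrix.
Variables (T : nat) (f : 'I_T -> 'cV[R]_n -> R) (p : nat) (delta : R).
Variables (H0 : 'M[R]_n) (K : nat -> {set 'I_T}) (x : nat -> 'cV[R]_n).

Definition step_s l : 'cV[R]_n := x l.+1 - x l.

Definition step_y l : 'cV[R]_n :=
  batch_gradient f (K l) (x l.+1) - batch_gradient f (K l) (x l).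

(* The matrix at step j uses the pairs l with j - p <= l < j, where j - p is
   truncated at 0, oldest first. No pair exists at step 0, where the matrix
   is an arbitrary fixed H0. *)
Definition SdLBFGS_matrix (j : nat) : 'M[R]_n :=
  if j is l.+1 then
    foldl (fun H i => bfgs_update H (step_s i)
                        (damped_y delta (step_s i) (step_y i)))
          (bfgs_gamma delta (step_s l) (step_y l))^-1%:M
          (index_iota (j - p) j)
  else H0.

(* Steps are numbered linearly: x (k * q + t) is the iterate x_t^{k+1}, for
   t <= q. Thus x (k * q) is the snapshot of outer iteration k, and the
   identities x_q^{k+1} = x_0^{k+2} between iterates hold by the numbering. *)
Definition SdLBFGS_VR_run (x0 : 'cV[R]_n) (alpha : nat -> nat -> R)
    (q N : nat) : Prop :=
  x 0%N = x0 /\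
  forall k t : nat, (k < N)%N -> (t < q)%N ->
    let j := (k * q + t)%N in
    x j.+1 = x j - alpha k t *:
      (SdLBFGS_matrix j *m vr_gradient f (K j) (x j) (x (k * q)%N)).

End matrix.
End damped_LBFGS.

Section sampling.
Context d (Om : measurableType d) (R : realType) (P : probability Om R).

Definition uniform_on (V : finType) (A : {pred V}) (X : Om -> V) : Prop :=
  forall v, measurable (X @^-1` [set v]) /\
    P (X @^-1` [set v]) = (if v \in A then #|A|%:R^-1 else 0)%:E.

(* Mutual independence of X 0, .., X (M - 1), Y, for finite-valued variables.
   Subfamilies are covered by taking some of the sets to be the full type. *)
Definition mutually_independent (V W : finType) (M : nat)
    (X : Om -> nat -> V) (Y : Om -> W) : Prop :=
  forall (A : 'I_M -> set V) (B : set W),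
    P [set w | (forall j : 'I_M, A j (X w j)) /\ B (Y w)] =
    ((\prod_(j < M) P [set w | A j (X w j)]) * P [set w | B (Y w)])%E.

End sampling.

(* N outer iterations, each with one full gradient (T evaluations) and q inner
   iterations of a * m evaluations. *)
Definition component_evals (T m a q N : nat) : nat := ((T + q * (a * m)) * N)%N.

(* Main.v *)
(* Along an epoch the Lyapunov function f(x_t) + c_t |x_t - x_0|^2 decreases in
   conditional expectation by at least Gamma |grad f(x_t)|^2, where
   Gamma >= nu m / (L T^(2/3)): the descent lemma and the eigenvalue bounds of H
   handle the deterministic part, and the variance of the gradient estimate over
   m-subsets is at most L^2 |x_t - x_0|^2 / m. As c vanishes at the end of an
   epoch, the epochs telescope and the mean squared gradient over all N q
   iterates is at most gap L T^(2/3) / (nu m N q).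
   All randomness is finite: the iterates are functions of the sample history,
   which is uniform on (m-subsets)^(N q), so conditioning on the past of step j
   amounts to averaging over the j-th coordinate of the history. *)
Require Import Defs.
From HB Require Import structures.
From mathcomp Require Import all_boot all_order all_algebra.
From mathcomp Require Import all_classical all_reals all_analysis.
From mathcomp Require Import fingroup perm.
From mathcomp Require Import measurable_realfun ring lra.
Set Implicit Arguments.
Unset Strict Implicit.
Unset Printing Implicit Defensive.
Import Order.TTheory GRing.Theory Num.Theory.
Import numFieldNormedType.Exports.
Local Open Scope classical_set_scope.
Local Open Scope ring_scope.

(** * Euclidean geometry and the descent lemma *)

Section euclidean.
Context {R : realType} {n : nat}.
Implicit Types (u v w : 'cV[R]_n) (H : 'M[R]_n).

Lemma dotE u v : dot u v = \sum_i u i 0 * v i 0.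
Proof. by rewrite /dot mxE; apply: eq_bigr => i _; rewrite mxE. Qed.

Lemma dotC u v : dot u v = dot v u.
Proof. by rewrite !dotE; apply: eq_bigr => i _; rewrite mulrC. Qed.

Lemma dotDr u v w : dot u (v + w) = dot u v + dot u w.
Proof. by rewrite /dot mulmxDr mxE. Qed.

Lemma dotZr u (a : R) v : dot u (a *: v) = a * dot u v.
Proof. by rewrite /dot -scalemxAr mxE. Qed.

Lemma dotNr u v : dot u (- v) = - dot u v.
Proof. by rewrite -scaleN1r dotZr mulN1r. Qed.

Lemma dotBr u v w : dot u (v - w) = dot u v - dot u w.
Proof. by rewrite dotDr dotNr. Qed.

Lemma dotDl u v w : dot (u + v) w = dot u w + dot v w.
Proof. by rewrite dotC dotDr !(dotC w). Qed.

Lemma dotZl (a : R) u v : dot (a *: u) v = a * dot u v.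
Proof. by rewrite dotC dotZr dotC. Qed.

Lemma dotNl u v : dot (- u) v = - dot u v.
Proof. by rewrite dotC dotNr dotC. Qed.

Lemma dotBl u v w : dot (u - v) w = dot u w - dot v w.
Proof. by rewrite dotDl dotNl. Qed.

Lemma dotBB u v :
  dot (u - v) (u - v) = dot u u - (2 * dot v (u - v) + dot v v).
Proof. rewrite !(dotBl, dotBr) (dotC v u); ring. Qed.

Lemma dot_sumr u (I : Type) (r : seq I) (P : pred I) (F : I -> 'cV[R]_n) :
  dot u (\sum_(i <- r | P i) F i) = \sum_(i <- r | P i) dot u (F i).
Proof.
apply: (big_morph (dot u)); first exact: dotDr.
by rewrite -(scale0r u) dotZr mul0r.
Qed.

Lemma dot_suml u (I : Type) (r : seq I) (P : pred I) (F : I -> 'cV[R]_n) :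
  dot (\sum_(i <- r | P i) F i) u = \sum_(i <- r | P i) dot (F i) u.
Proof. by rewrite dotC dot_sumr; apply: eq_bigr => i _; rewrite dotC. Qed.

Lemma dot_ge0 u : 0 <= dot u u.
Proof. by rewrite dotE sumr_ge0 // => i _; rewrite -expr2 sqr_ge0. Qed.

Lemma enorm_sqr u : enorm u ^+ 2 = dot u u.
Proof. by rewrite sqr_sqrtr // dot_ge0. Qed.

Lemma dot_mulmx H u v : dot u (H *m v) = dot (H^T *m u) v.
Proof. by rewrite /dot trmx_mul trmxK mulmxA. Qed.

Lemma loewner_scalar_le (a : R) H v :
  loewner_le a%:M H -> a * dot v v <= dot v (H *m v).
Proof.
by case=> _ /(_ v); rewrite mulmxBl dotBr mul_scalar_mx dotZr subr_ge0.
Qed.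

Lemma loewner_le_scalar (b : R) H v :
  loewner_le H b%:M -> dot v (H *m v) <= b * dot v v.
Proof.
by case=> _ /(_ v); rewrite mulmxBl dotBr mul_scalar_mx dotZr subr_ge0.
Qed.

Lemma loewner_sym (a : R) H : loewner_le a%:M H -> H^T = H.
Proof.
case=> + _; rewrite linearB /= tr_scalar_mx => E.
by rewrite -[LHS](subrK a%:M) E subrK.
Qed.

(* Positivity of the form H at v - b^-1 H v replaces the spectral theorem. *)
Lemma loewner_mulmx_le (a b : R) H v : 0 < a -> 0 < b ->
  loewner_le a%:M H -> loewner_le H b%:M ->
  dot (H *m v) (H *m v) <= b ^+ 2 * dot v v.
Proof.
move=> a0 b0 aH Hb.
have := loewner_scalar_le (v - b^-1 *: (H *m v)) aH.
have sym := loewner_sym aH.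
have := loewner_le_scalar v Hb; have := loewner_le_scalar (H *m v) Hb.
have : 0 <= a * dot (v - b^-1 *: (H *m v)) (v - b^-1 *: (H *m v)).
  by rewrite mulr_ge0 ?dot_ge0 // ltW.
rewrite [dot _ (H *m (_ - _))]dot_mulmx sym !mulmxBr -!scalemxAr.
rewrite !(dotBl, dotBr, dotZl, dotZr).
set x := dot v v; set y := dot v (H *m v).
have -> : dot (H *m v) v = y by rewrite dotC.
have -> : dot (H *m (H *m v)) v = dot (H *m v) (H *m v).
  by rewrite dotC dot_mulmx sym.
set z := dot (H *m v) (H *m v); rewrite [dot (H *m (H *m v)) _]dotC.
set t := dot (H *m v) (H *m (H *m v)).
move=> h0 h1 h2 h3.
have {h0 h3} h : 0 <= y - b^-1 * z - b^-1 * (z - b^-1 * t) by lra.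
(* Times [b], the form reads [b y - 2 z + t / b]; as [t <= b z], this gives [z <= b y], and
   [y <= b x] concludes. *)
have h4 : b * (y - b^-1 * z - b^-1 * (z - b^-1 * t)) = b * y - 2 * z + b^-1 * t.
  by field; lra.
have h5 : b^-1 * t <= z by rewrite ler_pdivrMl.
have : 0 <= b * (y - b^-1 * z - b^-1 * (z - b^-1 * t)) by rewrite mulr_ge0 // ltW.
have : b * y <= b * (b * x) by rewrite ler_pM2l.
rewrite h4 mulrA -expr2 => *; lra.
Qed.

(** Here [u] is the displacement from the snapshot, [v] the true gradient and [e] the error of its
    estimate. The terms linear in [e] are gathered into one inner product with a vector free of [e],
    so that they cancel on averaging. *)
Lemma dot_preconditioned (L klow kbar alpha beta c Fx Fx' : R) H u v e :
  0 < L -> 0 < klow -> 0 < kbar -> 0 <= alpha -> 0 < beta -> 0 <= c ->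
  loewner_le klow%:M H -> loewner_le H kbar%:M ->
  Fx' <= Fx - alpha * dot v (H *m (v + e))
         + L / 2 * (alpha ^+ 2 * dot (H *m (v + e)) (H *m (v + e))) ->
  Fx' + c * dot (u - alpha *: (H *m (v + e))) (u - alpha *: (H *m (v + e)))
  <= Fx + c * (1 + alpha * beta) * dot u u
     - (alpha * klow - c * alpha * kbar ^+ 2 / beta
        - alpha ^+ 2 * L * kbar ^+ 2 / 2 - c * alpha ^+ 2 * kbar ^+ 2) * dot v v
     + dot (- alpha *: (H *m v) + (L * alpha ^+ 2 * kbar ^+ 2) *: v
            + c *: (- (2 * alpha) *: (H *m u)
                    + (2 * alpha ^+ 2 * kbar ^+ 2) *: v)) e
     + (L * alpha ^+ 2 * kbar ^+ 2 / 2 + c * alpha ^+ 2 * kbar ^+ 2) * dot e e.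
Proof.
move=> L_gt0 klow_gt0 kbar_gt0 alpha_ge0 beta_gt0 c_ge0 Hlow Hup.
have sym := loewner_sym Hlow.
have [h hE] : exists h, h = H *m (v + e) by exists (H *m (v + e)).
rewrite -hE => d1.
have d2 : dot h h <= kbar ^+ 2 * (dot v v + 2 * dot v e + dot e e).
  rewrite hE; apply: (le_trans (loewner_mulmx_le (v + e) klow_gt0 kbar_gt0 Hlow Hup)).
  by rewrite dotDl !dotDr (dotC e v) le_eqVlt; apply/orP; left; apply/eqP; ring.
have d3 := loewner_scalar_le v Hlow.
have d4 := loewner_mulmx_le v klow_gt0 kbar_gt0 Hlow Hup.
(* Young's inequality with weight [beta], from the square of [beta u + H v]. *)
have d5 : - (2 * dot u (H *m v)) <= beta * dot u u + kbar ^+ 2 / beta * dot v v.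
  have : 0 <= beta^-1 * dot (beta *: u + H *m v) (beta *: u + H *m v).
    by rewrite mulr_ge0 ?dot_ge0 // invr_ge0 ltW.
  have -> : beta^-1 * dot (beta *: u + H *m v) (beta *: u + H *m v)
      = beta * dot u u + 2 * dot u (H *m v) + beta^-1 * dot (H *m v) (H *m v).
    rewrite !(dotDl, dotDr, dotZl, dotZr) (dotC (H *m v) u).
    by field; rewrite gt_eqF.
  have : beta^-1 * dot (H *m v) (H *m v) <= beta^-1 * (kbar ^+ 2 * dot v v).
    by rewrite ler_pM2l // invr_gt0.
  by lra.
have -> : dot (u - alpha *: h) (u - alpha *: h)
    = dot u u - 2 * alpha * dot u h + alpha ^+ 2 * dot h h.
  rewrite !(dotBl, dotBr, dotZl, dotZr) (dotC h u); ring.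
have vh : dot v h = dot v (H *m v) + dot (H *m v) e.
  by rewrite hE mulmxDr dotDr (dot_mulmx H v e) sym.
have uh : dot u h = dot u (H *m v) + dot (H *m u) e.
  by rewrite hE mulmxDr dotDr (dot_mulmx H u e) sym.
rewrite vh uh in d1 *; rewrite !(dotDl, dotZl).
move: d1 d2 d3 d5; clear d4 vh uh.
move: (dot v v) (dot v e) (dot e e) (dot u u) (dot u (H *m v)) (dot v (H *m v))
  (dot (H *m v) e) (dot (H *m u) e) (dot h h).
move=> vv ve ee uu uHv vHv Hve Hue hh d1 d2 d3 d5.
have e2 : (L / 2 * alpha ^+ 2 + c * alpha ^+ 2) * hh
    <= (L / 2 * alpha ^+ 2 + c * alpha ^+ 2) * (kbar ^+ 2 * (vv + 2 * ve + ee)).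
  by rewrite ler_wpM2l // addr_ge0 // mulr_ge0 ?sqr_ge0 // divr_ge0 // ltW.
have e3 := ler_wpM2l alpha_ge0 d3.
have e5 := ler_wpM2l (mulr_ge0 c_ge0 alpha_ge0) d5.
by lra.
Qed.

End euclidean.

Section descent.
Context {R : realType} {n : nat}.
Implicit Types (f : 'cV[R]_n -> R) (x d : 'cV[R]_n).

Lemma derive_gradient f x d :
  differentiable f x -> 'D_d f x = dot (gradient f x) d.
Proof.
move=> df; rewrite deriveE // dotE.
have -> : d = \sum_i d i 0 *: delta_mx i 0 :> 'cV[R]_n.
  by rewrite [LHS]matrix_sum_delta; apply: eq_bigr => i _; rewrite big_ord1.
rewrite linear_sum; apply: eq_bigr => i _ /=.
by rewrite linearZ /= !mxE deriveE // mulrC summxE (bigD1 i) //= big1 ?addr0 => [|j ji];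
  rewrite !mxE ?eqxx ?mulr1 // eq_sym (negPf ji) mulr0.
Qed.

Lemma is_derive_line f x d (t : R) : differentiable f (x + t *: d) ->
  is_derive t 1 (fun s : R => f (x + s *: d))
    (dot (gradient f (x + t *: d)) d).
Proof.
move=> df; have dv := @diff_derivable _ _ _ _ _ d df.
have E : (fun h : R => h^-1 *: (f (x + (h *: 1 + t) *: d) - f (x + t *: d))) =
         (fun h : R => h^-1 *: (f (h *: d + (x + t *: d)) - f (x + t *: d))).
  apply/funext => h; congr (_ *: (f _ - _)).
  by rewrite (_ : h *: 1 = h) ?scalerDl 1?addrCA //; exact: mulr1.
split; first by rewrite /derivable /= E; exact: dv.
by rewrite -derive_gradient // /derive /= E.
Qed.

(** The mean value theorem is applied to [f (x + t d)] minus the linear and quadratic terms of the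
    bound; the Lipschitz gradient makes the derivative at the intermediate point nonpositive. *)
Lemma descent f (L : R) x d : 0 < L -> (forall y, differentiable f y) ->
  (forall y z, enorm (gradient f y - gradient f z) <= L * enorm (y - z)) ->
  f (x + d) <= f x + dot (gradient f x) d + L / 2 * dot d d.
Proof.
move=> L0 df lip.
pose g t := f (x + t *: d) - t * dot (gradient f x) d - t ^+ 2 * (L / 2 * dot d d).
have dg (t : R) : is_derive t 1 g (dot (gradient f (x + t *: d)) d
    - dot (gradient f x) d - 2 * t * (L / 2 * dot d d)).
  have h1 := is_derive_line (df (x + t *: d)).
  rewrite /g; apply: is_derive_eq; rewrite /GRing.scale /=; ring.
have cg : {within `[0, 1], continuous g}.
  apply: continuous_subspaceT => t; apply: differentiable_continuous.
  by apply/derivable1_diffP; case: (dg t).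
have [c cI] := MVT ltr01 (fun t _ => dg t) cg.
rewrite subr0 mulr1 /g scale1r scale0r addr0 !mul1r expr1n expr0n /= !mul0r !subr0.
have c0 : 0 < c by case/andP: cI.
have hc : enorm (gradient f (x + c *: d) - gradient f x) ^+ 2
    <= L ^+ 2 * (c ^+ 2 * dot d d).
  have := lip (x + c *: d) x; rewrite addrAC subrr add0r => h.
  have -> : L ^+ 2 * (c ^+ 2 * dot d d) = (L * enorm (c *: d)) ^+ 2.
    by rewrite exprMn enorm_sqr dotZl dotZr; ring.
  by rewrite ler_sqr ?nnegrE ?sqrtr_ge0 // mulr_ge0 ?sqrtr_ge0 // ltW.
have Lc : 0 < L * c by rewrite mulr_gt0.
(* The needed case of Cauchy-Schwarz, from the square of [e - (L c) d]. *)
have key e : dot e e <= L ^+ 2 * (c ^+ 2 * dot d d) -> dot e d <= L * c * dot d d.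
  move=> he; have := dot_ge0 (e - (L * c) *: d).
  rewrite !(dotBl, dotBr, dotZl, dotZr) (dotC d e) => h.
  by rewrite -(ler_pM2l Lc); lra.
move: hc; rewrite enorm_sqr => /key; rewrite dotBl => h1 h2; lra.
Qed.

Lemma descent_step f (L : R) x (a : R) h : 0 < L ->
  (forall y, differentiable f y) ->
  (forall y z, enorm (gradient f y - gradient f z) <= L * enorm (y - z)) ->
  f (x - a *: h)
  <= f x - a * dot (gradient f x) h + L / 2 * (a ^+ 2 * dot h h).
Proof.
move=> L0 df lip; have := descent x (- (a *: h)) L0 df lip.
by rewrite dotNr dotZr dotNl dotZl dotNr dotZr (mulrN a) opprK (mulrA a).
Qed.

End descent.

(** * Sampling m-subsets and one step of the Lyapunov function *)

Section subset_sampling.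
Context {R : realType} {T n : nat} (m : nat).
Implicit Types (A : {set 'I_T}) (a : 'I_T -> 'cV[R]_n).

(** Divided by the number of m-subsets, this is the joint inclusion probability of [i] and [j] under
    sampling without replacement. *)
Definition subsets_through (i j : 'I_T) : R :=
  \sum_(A : {set 'I_T} | #|A| == m) ((i \in A) && (j \in A))%:R.

Lemma subsets_through_perm (s : {perm 'I_T}) i j :
  subsets_through (s i) (s j) = subsets_through i j.
Proof.
rewrite /subsets_through (reindex_inj (imset_inj (@perm_inj _ s))) /=.
apply: eq_big => A; first by rewrite card_imset //; exact: perm_inj.
by rewrite !mem_imset //; exact: perm_inj.
Qed.

(** Permutations act transitively on ordered pairs of distinct indices, so the off-diagonal count is
    constant; only its sign is used later. *)
Lemma subsets_through_neq :
  exists2 p : R, 0 <= p & forall i j, i != j -> subsets_through i j = p.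
Proof.
case: (pickP (fun ij : 'I_T * 'I_T => ij.1 != ij.2)) => [[i j] /= ij|none].
  exists (subsets_through i j); first by rewrite sumr_ge0.
  move=> k l kl; pose s := (tperm i k * tperm (tperm i k j) l)%g.
  (* The first transposition takes [i] to [k]; the second moves the image of [j] to [l] and fixes
     [k], which differs from both. *)
  have si : s i = k.
    have : tperm i k j != tperm i k i by rewrite (inj_eq perm_inj) eq_sym.
    by rewrite permM tpermL => h; rewrite tpermD // eq_sym.
  have sj : s j = l by rewrite permM tpermL.
  by rewrite -[in LHS]si -[in LHS]sj subsets_through_perm.
by exists 0 => // i j ij; have := none (i, j); rewrite /= ij.
Qed.

(** By symmetry all diagonal counts are equal, and their sum double counts the pairs of an m-subset
    and one of its elements. *)
Lemma subsets_through_diag i :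
  T%:R * subsets_through i i
  = m%:R * #|[pred A : {set 'I_T} | #|A| == m]|%:R.
Proof.
have -> : T%:R * subsets_through i i = \sum_j subsets_through j j.
  rewrite mulr_natl -[in LHS](card_ord T) -sumr_const.
  apply: eq_bigr => j _.
  by rewrite -(subsets_through_perm (tperm i j)) tpermL.
rewrite exchange_big /= mulr_natr -sumr_const.
apply: eq_big => [A|A /eqP <-]; first by rewrite inE.
rewrite -sum1_card natr_sum [RHS]big_mkcond /=.
by apply: eq_bigr => i' _; rewrite andbb; case: (i' \in A).
Qed.

Lemma sum_subset_sum a :
  \sum_(A : {set 'I_T} | #|A| == m) \sum_(i in A) a i
  = \sum_i subsets_through i i *: a i.
Proof.
under eq_bigr do rewrite big_mkcond /=.
rewrite exchange_big /=; apply: eq_bigr => i _.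
rewrite scaler_suml; apply: eq_bigr => A _; rewrite andbb.
by case: (i \in A); rewrite ?scale1r ?scale0r.
Qed.

Lemma sum_subset_sum_eq0 a : (0 < T)%N -> \sum_i a i = 0 ->
  \sum_(A : {set 'I_T} | #|A| == m) \sum_(i in A) a i = 0.
Proof.
move=> T0 a0; rewrite sum_subset_sum.
have T0' : T%:R != 0 :> R by rewrite pnatr_eq0 -lt0n.
under eq_bigr => i _.
  rewrite -[subsets_through i i](mulKf T0') subsets_through_diag.
  over.
by rewrite -scaler_sumr a0 scaler0.
Qed.

(* Sampling without replacement does not increase the variance: distinct
   indices are nonnegatively weighted by a constant, which cancels against
   the square of the vanishing total sum. *)
Lemma sum_subset_sqnorm_le a : (0 < T)%N -> \sum_i a i = 0 ->
  \sum_(A : {set 'I_T} | #|A| == m)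
     dot (\sum_(i in A) a i) (\sum_(i in A) a i)
  <= #|[pred A : {set 'I_T} | #|A| == m]|%:R * m%:R / T%:R
     * \sum_i dot (a i) (a i).
Proof.
move=> T0 a0; have T0' : T%:R != 0 :> R by rewrite pnatr_eq0 -lt0n.
have [p p0 hp] := subsets_through_neq.
have -> : \sum_(A : {set 'I_T} | #|A| == m)
    dot (\sum_(i in A) a i) (\sum_(i in A) a i)
    = \sum_i \sum_j subsets_through i j * dot (a i) (a j).
  transitivity (\sum_(A : {set 'I_T} | #|A| == m)
     \sum_i \sum_j ((i \in A) && (j \in A))%:R * dot (a i) (a j)).
    apply: eq_bigr => A _; rewrite dot_suml big_mkcond /=.
    apply: eq_bigr => i _; rewrite dot_sumr big_mkcond /=.
    case: (i \in A) => /=; last by rewrite big1 // => j _; rewrite mul0r.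
    by apply: eq_bigr => j _; case: (j \in A); rewrite ?mul1r ?mul0r.
  rewrite exchange_big /=; apply: eq_bigr => i _.
  rewrite exchange_big /=; apply: eq_bigr => j _.
  by rewrite mulr_suml.
have -> : \sum_i \sum_j subsets_through i j * dot (a i) (a j)
    = \sum_i (subsets_through i i - p) * dot (a i) (a i).
  transitivity (\sum_i ((subsets_through i i - p) * dot (a i) (a i)
                 + p * dot (a i) (\sum_j a j))).
    apply: eq_bigr => i _; rewrite dot_sumr (bigD1 i) //= [X in p * X](bigD1 i) //=.
    rewrite mulrDr mulr_sumr addrA -mulrDl subrK; congr (_ + _).
    by apply: eq_bigr => j ji; rewrite hp // eq_sym.
  apply: eq_bigr => i _; rewrite a0 -(scale0r (a i)) dotZr mul0r mulr0.
  by rewrite addr0.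
rewrite mulr_sumr; apply: ler_sum => i _; apply: ler_wpM2r; first exact: dot_ge0.
rewrite -[subsets_through i i](mulKf T0') subsets_through_diag.
by rewrite lerBlDr [_^-1 * _]mulrC [m%:R * _]mulrC lerDl.
Qed.

End subset_sampling.

(** * The variance-reduced gradient estimate and its effect on one step *)

Section step.
Context {R : realType} {T n : nat}.
Variables (f : 'I_T -> 'cV[R]_n -> R) (m : nat).
Hypotheses (m_gt0 : (0 < m)%N) (m_le_T : (m <= T)%N).
Let S : pred {set 'I_T} := [pred A : {set 'I_T} | #|A| == m].

Lemma card_subsets_gt0 : 0 < #|S|%:R :> R.
Proof.
rewrite ltr0n; apply/card_gt0P.
have := card_draws 'I_T m; rewrite card_ord => h.
by move: m_le_T; rewrite -bin_gt0 -h => /card_gt0P[A]; rewrite inE; exists A.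
Qed.

Definition vr_error A x xs := vr_gradient f A x xs - gradient (objective f) x.

Section moments.
Variables (L sigma : R) (x xs : 'cV[R]_n).
Hypotheses (smooth : sample_smooth f L).
Hypotheses (hx : AS2_at f sigma x) (hxs : AS2_at f sigma xs).

(** Increments of the sample gradients, centred by their mean: they sum to zero over all indices,
    and [vr_error] is their average over the batch. *)
Let dev i := gradient (f i) x - gradient (f i) xs
             - (gradient (objective f) x - gradient (objective f) xs).

Let T_neq0 : T%:R != 0 :> R.
Proof. by rewrite pnatr_eq0 -lt0n (leq_trans m_gt0). Qed.

Let sum_gradient y : AS2_at f sigma y ->
  \sum_i gradient (f i) y = T%:R *: gradient (objective f) y.
Proof. by case=> <- _; rewrite scalerA divff // scale1r. Qed.

Let sum_dev : \sum_i dev i = 0.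
Proof.
rewrite sumrB sumr_const card_ord -scaler_nat sumrB scalerBr.
by rewrite (sum_gradient hx) (sum_gradient hxs) subrr.
Qed.

Let vr_errorE A : A \in S -> vr_error A x xs = m%:R^-1 *: \sum_(i in A) dev i.
Proof.
rewrite inE => /eqP Am; rewrite /vr_error /vr_gradient /batch_gradient Am.
have m0 : m%:R != 0 :> R by rewrite pnatr_eq0 -lt0n.
rewrite sumrB sumr_const Am scalerBr -[(_ - _) *+ m]scaler_nat scalerA mulVf // scale1r.
by rewrite sumrB scalerBr opprB addrA.
Qed.

Lemma sum_vr_error : \sum_(A in S) vr_error A x xs = 0.
Proof.
rewrite (eq_bigr _ vr_errorE) -scaler_sumr.
have -> : \sum_(A in S) \sum_(i in A) dev i
        = \sum_(A : {set 'I_T} | #|A| == m) \sum_(i in A) dev i.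
  by apply: eq_bigl => A; rewrite inE.
by rewrite sum_subset_sum_eq0 ?scaler0 // (leq_trans m_gt0).
Qed.

(** Averaging over an m-subset divides the mean square of the deviations by at least [m], centring
    only lowers a second moment, and [sample_smooth] bounds that moment. *)
Lemma sum_vr_error_sqnorm :
  \sum_(A in S) dot (vr_error A x xs) (vr_error A x xs)
  <= #|S|%:R * (L ^+ 2 / m%:R * dot (x - xs) (x - xs)).
Proof.
have m0 : 0 < m%:R :> R by rewrite ltr0n.
have T0 : 0 < T%:R :> R by rewrite ltr0n (leq_trans m_gt0).
have -> : \sum_(A in S) dot (vr_error A x xs) (vr_error A x xs)
        = m%:R^-1 ^+ 2 * \sum_(A : {set 'I_T} | #|A| == m)
             dot (\sum_(i in A) dev i) (\sum_(i in A) dev i).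
  rewrite mulr_sumr; apply: eq_big => [A|A AS]; first by rewrite inE.
  by rewrite vr_errorE // dotZl dotZr mulrA.
have h1 : m%:R^-1 ^+ 2 * \sum_(A : {set 'I_T} | #|A| == m)
             dot (\sum_(i in A) dev i) (\sum_(i in A) dev i)
    <= m%:R^-1 ^+ 2 * (#|S|%:R * m%:R / T%:R * \sum_i dot (dev i) (dev i)).
  apply: ler_wpM2l; first by rewrite sqr_ge0.
  by apply: sum_subset_sqnorm_le => //; rewrite (leq_trans m_gt0).
apply: (le_trans h1).
have h2 : \sum_i dot (dev i) (dev i)
    <= \sum_(i < T) enorm (gradient (f i) x - gradient (f i) xs) ^+ 2.
  (* The squared deviations sum to the second moment minus [T |g|^2], as the cross terms cancel. *)
  set g := gradient (objective f) x - gradient (objective f) xs.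
  have -> : \sum_i dot (dev i) (dev i)
      = \sum_(i < T) enorm (gradient (f i) x - gradient (f i) xs) ^+ 2
        - T%:R * dot g g.
    have -> : \sum_i dot (dev i) (dev i) = \sum_(i < T)
       (enorm (gradient (f i) x - gradient (f i) xs) ^+ 2
        - (2 * dot g (dev i) + dot g g)).
      by apply: eq_bigr => i _; rewrite enorm_sqr -dotBB.
    rewrite sumrB big_split /= -mulr_sumr -dot_sumr sum_dev sumr_const card_ord.
    by rewrite -{1}(scale0r g) dotZr mul0r mulr0 add0r mulr_natl.
  by rewrite gerBl mulr_ge0 ?dot_ge0 // ltW.
have h3 := smooth x xs.
have h4 : \sum_i dot (dev i) (dev i) <= T%:R * (L ^+ 2 * enorm (x - xs) ^+ 2).
  by apply: (le_trans h2); rewrite -ler_pdivrMl.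
have c0 : 0 <= m%:R^-1 ^+ 2 * (#|S|%:R * m%:R / T%:R) :> R.
  by rewrite !mulr_ge0 ?sqr_ge0 ?invr_ge0 // ltW.
rewrite mulrA; apply: (le_trans (ler_wpM2l c0 h4)).
rewrite enorm_sqr le_eqVlt; apply/orP; left; apply/eqP.
by field; rewrite !gt_eqF.
Qed.

End moments.

Section lyapunov.
Variables (L sigma klow kbar alpha beta c : R) (H : 'M[R]_n) (x xs : 'cV[R]_n).
Hypotheses (L_gt0 : 0 < L) (klow_gt0 : 0 < klow) (kbar_gt0 : 0 < kbar).
Hypotheses (alpha_ge0 : 0 <= alpha) (beta_gt0 : 0 < beta) (c_ge0 : 0 <= c).
Hypotheses (as1 : AS1 f L) (smooth : sample_smooth f L).
Hypotheses (hx : AS2_at f sigma x) (hxs : AS2_at f sigma xs).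
Hypotheses (Hlow : loewner_le klow%:M H) (Hup : loewner_le H kbar%:M).

Let F := objective f.
Let v := gradient F x.
Let next A := x - alpha *: (H *m vr_gradient f A x xs).

(** The witness depends on [x], [xs] and [H] but not on the sample [A], which lets the linear term
    average to zero. *)
Lemma lyapunov_pointwise : exists w, forall A,
  F (next A) + c * dot (next A - xs) (next A - xs)
  <= F x + c * (1 + alpha * beta) * dot (x - xs) (x - xs)
     - (alpha * klow - c * alpha * kbar ^+ 2 / beta - alpha ^+ 2 * L * kbar ^+ 2 / 2
        - c * alpha ^+ 2 * kbar ^+ 2) * dot v v
     + dot w (vr_error A x xs)
     + (L * alpha ^+ 2 * kbar ^+ 2 / 2 + c * alpha ^+ 2 * kbar ^+ 2)
       * dot (vr_error A x xs) (vr_error A x xs).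
Proof.
exists (- alpha *: (H *m v) + (L * alpha ^+ 2 * kbar ^+ 2) *: v
        + c *: (- (2 * alpha) *: (H *m (x - xs))
                + (2 * alpha ^+ 2 * kbar ^+ 2) *: v)) => A.
have gE : vr_gradient f A x xs = v + vr_error A x xs by rewrite addrC subrK.
rewrite /next gE addrAC.
apply: (dot_preconditioned (x - xs)) => //.
by have [[df _] _ lip] := as1; apply: descent_step.
Qed.

Lemma lyapunov_step :
  \sum_(A in S) (F (next A) + c * dot (next A - xs) (next A - xs))
  <= #|S|%:R *
     (F x + (c * (1 + alpha * beta + 2 * L ^+ 2 * alpha ^+ 2 * kbar ^+ 2 / m%:R)
             + alpha ^+ 2 * L ^+ 3 * kbar ^+ 2 / m%:R) * dot (x - xs) (x - xs)
      - (alpha * klow - c * alpha * kbar ^+ 2 / beta - alpha ^+ 2 * L * kbar ^+ 2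
         - 2 * c * alpha ^+ 2 * kbar ^+ 2) * dot v v).
Proof.
have [w hw] := lyapunov_pointwise.
apply: (le_trans (ler_sum _ (fun A _ => hw A))).
rewrite 2!big_split /= -mulr_sumr -(dot_sumr w) (sum_vr_error hx hxs).
have -> : dot w (0 : 'cV[R]_n) = 0 by rewrite -(scale0r w) dotZr mul0r.
rewrite addr0 sumr_const -[X in X + _]mulr_natl.
have := sum_vr_error_sqnorm smooth hx hxs.
move: card_subsets_gt0 (dot_ge0 (x - xs)) (dot_ge0 v).
have : 0 < m%:R :> R by rewrite ltr0n.
set r := dot (x - xs) _; set vv := dot v v; set V := \sum_(A in S) _.
move: (#|S|%:R : R) (m%:R : R) (F x) => s mr Fx mr0 s0 r0 v0 hV.
set k := L * alpha ^+ 2 * kbar ^+ 2 / 2 + c * alpha ^+ 2 * kbar ^+ 2.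
have k0 : 0 <= k.
  by rewrite /k addr_ge0 ?divr_ge0 // !mulr_ge0 ?sqr_ge0 // ltW.
have {hV} hV := ler_wpM2l k0 hV.
rewrite -subr_ge0 in hV; rewrite -subr_ge0.
apply: (le_trans hV); rewrite -subr_ge0.
set rhs := (X in 0 <= X).
(* The [alpha ^+ 2] coefficients of the statement are twice those that averaging gives; the slack is
   this nonnegative remainder. *)
suff -> : rhs = s * ((k * L ^+ 2 / mr) * r + (alpha ^+ 2 * kbar ^+ 2) * (L / 2 + c) * vv).
  have h1 : 0 <= k * L ^+ 2 / mr by rewrite divr_ge0 ?mulr_ge0 ?sqr_ge0 // ltW.
  have h2 : 0 <= alpha ^+ 2 * kbar ^+ 2 * (L / 2 + c).
    apply: mulr_ge0; first by rewrite mulr_ge0 ?sqr_ge0.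
    by apply: addr_ge0 => //; rewrite divr_ge0 // ltW.
  by rewrite pmulr_rge0 // addr_ge0 // mulr_ge0.
by rewrite /rhs /k; field; rewrite !gt_eqF.
Qed.

End lyapunov.
End step.

(** * Expected descent over sample histories *)

Section determinism.
Context {R : realType} {T n : nat}.
Variables (f : 'I_T -> 'cV[R]_n -> R) (p : nat) (delta : R) (H0 : 'M[R]_n).

(** Non-anticipation: the newest pair at step [j] has index [j - 1] and reads [K (j - 1)],
    [x (j - 1)] and [x j]. *)
Lemma SdLBFGS_matrix_ext K K' (x x' : nat -> 'cV[R]_n) j :
  (forall i, (i < j)%N -> K i = K' i) -> (forall i, (i <= j)%N -> x i = x' i) ->
  SdLBFGS_matrix f p delta H0 K x j = SdLBFGS_matrix f p delta H0 K' x' j.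
Proof.
case: j => [//|l] eK ex.
have es i (il : (i < l.+1)%N) : step_s x i = step_s x' i.
  by congr (_ - _); apply: ex => //; apply: ltnW.
have ey i (il : (i < l.+1)%N) : step_y f K x i = step_y f K' x' i.
  by rewrite /step_y (eK i il) (ex i (ltnW il)) (ex i.+1 il).
rewrite /SdLBFGS_matrix (es l (ltnSn l)) (ey l (ltnSn l)).
have foldl_ext (g g' : 'M[R]_n -> nat -> 'M[R]_n) B s :
    (forall C i, i \in s -> g C i = g' C i) -> foldl g B s = foldl g' B s.
  elim: s B => [//|i s IH] B e; rewrite /= (e _ i (mem_head _ _)).
  by apply: IH => C k ks; apply: e; rewrite inE ks orbT.
apply: foldl_ext => B i; rewrite mem_index_iota => /andP[_ il].
by rewrite (es i il) (ey i il).
Qed.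

(** By strong induction, since a step reads the snapshot and up to [p] older pairs besides the
    current iterate. This makes the iterates functions of the sample history. *)
Lemma SdLBFGS_VR_run_ext K K' x x' x0 alpha q N j :
  SdLBFGS_VR_run f p delta H0 K x x0 alpha q N ->
  SdLBFGS_VR_run f p delta H0 K' x' x0 alpha q N ->
  (j <= N * q)%N -> (forall i, (i < j)%N -> K i = K' i) -> x j = x' j.
Proof.
move=> [x_0 run] [x'_0 run']; elim/ltn_ind: j => -[|j] IH jN eK.
  by rewrite x_0 x'_0.
have q0 : (0 < q)%N by case: (q) jN => //; rewrite muln0.
have ex i : (i <= j)%N -> x i = x' i.
  move=> ij; apply: IH => [//||l li]; first exact: leq_trans (ltnW _) jN.
  by apply: eK; rewrite (leq_trans li) // ltnW.
have kN : (j %/ q < N)%N by rewrite ltn_divLR.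
have := run _ _ kN (ltn_pmod j q0); have := run' _ _ kN (ltn_pmod j q0).
rewrite /= -divn_eq => -> ->.
rewrite (SdLBFGS_matrix_ext (fun i ij => eK i (ltnW ij)) ex).
by rewrite (eK j (ltnSn j)) (ex j (leqnn j)) (ex _ (leq_trunc_div j q)).
Qed.

End determinism.

(** * Averaging over one coordinate of a history *)

Section resampling.
Context {R : realType} {V : finType} {M : nat} (S : {pred V}).

Definition resample (z : {ffun 'I_M -> V}) (j : 'I_M) (A : V) :
  {ffun 'I_M -> V} := [ffun i => if i == j then A else z i].

Lemma resample_on z j A :
  z \in ffun_on S -> A \in S -> resample z j A \in ffun_on S.
Proof.
move=> /ffun_onP zS AS; apply/ffun_onP => i.
by rewrite ffunE; case: eqP.
Qed.

(* The map (z, A) |-> (resample z j A, z j) is an involution. *)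
Lemma sum_resample (F : {ffun 'I_M -> V} -> R) (j : 'I_M) :
  \sum_(z in ffun_on S) \sum_(A in S) F (resample z j A)
  = #|S|%:R * \sum_(z in ffun_on S) F z.
Proof.
rewrite mulr_sumr.
under [RHS]eq_bigr do rewrite mulr_natl -sumr_const.
rewrite !pair_big /=.
pose h (u : {ffun 'I_M -> V} * V) := (resample u.1 j u.2, u.1 j).
have hK : involutive h.
  move=> [z A]; rewrite /h /= ffunE eqxx; congr pair.
  by apply/ffunP => i; rewrite !ffunE; case: eqP => [->|].
rewrite [RHS](reindex_inj (inv_inj hK)) /=.
apply: eq_bigl => -[z A] /=; apply/andP/andP => [[zS AS]|[zS zj]].
  by rewrite resample_on //; split => //; move/ffun_onP: zS.
have AS : A \in S by move/ffun_onP: zS => /(_ j); rewrite ffunE eqxx.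
split=> //; apply/ffun_onP => i; move/ffun_onP: zS => /(_ i).
by rewrite ffunE; case: eqP => [->|].
Qed.

End resampling.

Lemma telescope_ord (V : zmodType) (u : nat -> V) q :
  u 0%N - u q = \sum_(t < q) (u t - u t.+1).
Proof.
rewrite -opprB -(telescope_sumr u (leq0n q)) -sumrN big_mkord.
by apply: eq_bigr => t _; rewrite opprB.
Qed.

Section expected_descent.
Context {R : realType} {T n : nat}.
Variables (f : 'I_T -> 'cV[R]_n -> R) (m p q N : nat).
Variables (L sigma klow kbar alpha beta delta Gamma : R).
Variables (H0 : 'M[R]_n) (x0 : 'cV[R]_n) (c : nat -> nat -> R).
Let M := (N * q)%N.
Let S : pred {set 'I_T} := [pred A : {set 'I_T} | #|A| == m].
Let F := objective f.
Variables (KK : {ffun 'I_M -> {set 'I_T}} -> nat -> {set 'I_T}).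
Variables (X : {ffun 'I_M -> {set 'I_T}} -> nat -> 'cV[R]_n).
Hypotheses (m_gt0 : (0 < m)%N) (m_le_T : (m <= T)%N).
Hypotheses (L_gt0 : 0 < L) (klow_gt0 : 0 < klow) (kbar_gt0 : 0 < kbar).
Hypotheses (alpha_ge0 : 0 <= alpha) (beta_gt0 : 0 < beta).
Hypotheses (as1 : AS1 f L) (smooth : sample_smooth f L).
Hypothesis KKE : forall z (i : 'I_M), z \in ffun_on S -> KK z i = z i.
Hypothesis run : forall z, z \in ffun_on S ->
  SdLBFGS_VR_run f p delta H0 (KK z) (X z) x0 (fun _ _ => alpha) q N.
Hypothesis as2 : forall z j, z \in ffun_on S -> (j <= M)%N ->
  AS2_at f sigma (X z j).
Hypothesis bounds : forall z j, z \in ffun_on S -> (j < M)%N ->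
  loewner_le klow%:M (SdLBFGS_matrix f p delta H0 (KK z) (X z) j) /\
  loewner_le (SdLBFGS_matrix f p delta H0 (KK z) (X z) j) kbar%:M.
Hypothesis cq : forall k, c k q = 0.
Hypothesis c_rec : forall k t, (t < q)%N ->
  c k t = c k t.+1 * (1 + alpha * beta
                      + 2 * L ^+ 2 * alpha ^+ 2 * kbar ^+ 2 / m%:R)
          + alpha ^+ 2 * L ^+ 3 * kbar ^+ 2 / m%:R.
Hypothesis c_ge0 : forall k t, (t < q)%N -> 0 <= c k t.+1.
Hypothesis Gamma_le : forall k t, (t < q)%N ->
  Gamma <= alpha * klow - c k t.+1 * alpha * kbar ^+ 2 / beta
           - alpha ^+ 2 * L * kbar ^+ 2 - 2 * c k t.+1 * alpha ^+ 2 * kbar ^+ 2.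

Let grad2 z j := dot (gradient F (X z j)) (gradient F (X z j)).
Let lyap k t z := F (X z (k * q + t)%N)
  + c k t * dot (X z (k * q + t)%N - X z (k * q)%N)
                (X z (k * q + t)%N - X z (k * q)%N).

Let index_lt k t : (k < N)%N -> (t < q)%N -> (k * q + t < M)%N.
Proof.
move=> kN tq; apply: (@leq_trans (k.+1 * q)).
  by rewrite mulSn addnC ltn_add2r.
by rewrite leq_mul2r kN orbT.
Qed.

Let X_ext z z' j : z \in ffun_on S -> z' \in ffun_on S -> (j <= M)%N ->
  (forall i : 'I_M, (i < j)%N -> z i = z' i) -> X z j = X z' j.
Proof.
move=> zS zS' jM e; apply: (SdLBFGS_VR_run_ext (run zS) (run zS') jM) => i ij.
have iM : (i < M)%N := leq_trans ij jM.
by rewrite -[i]/(val (Ordinal iM)) !KKE // e.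
Qed.

(** Resampling coordinate [j] of the history plays the role of the expectation conditional on the
    past, to which [lyapunov_step] applies. *)
Lemma expected_step k t : (k < N)%N -> (t < q)%N ->
  Gamma * \sum_(z in ffun_on S) grad2 z (k * q + t)%N
  <= \sum_(z in ffun_on S) lyap k t z - \sum_(z in ffun_on S) lyap k t.+1 z.
Proof.
move=> kN tq; have jM := index_lt kN tq; set j := (k * q + t)%N in jM *.
pose o : 'I_M := Ordinal jM.
have s0 : 0 < #|S|%:R :> R := card_subsets_gt0 m_le_T.
rewrite lerBrDr -lerBrDl mulr_sumr -sumrB.
rewrite -(ler_pM2l s0) -(sum_resample S _ o) mulr_sumr.
apply: ler_sum => z zS.
have [Hl Hu] := bounds zS jM.
have kqj : (k * q <= j)%N by rewrite leq_addr.
have hs := as2 zS (leq_trans kqj (ltnW jM)).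
have := lyapunov_step m_gt0 m_le_T L_gt0 klow_gt0 kbar_gt0 alpha_ge0 beta_gt0
  (c_ge0 k tq) as1 smooth (as2 zS (ltnW jM)) hs Hl Hu.
rewrite -c_rec // -/S -/F.
set lhs := (X in X <= _ -> _) => h.
(* Iterate, snapshot and matrix at [j] read only coordinates before [j], so they are those of [z];
   the new iterate uses the fresh sample [A]. *)
have -> : \sum_(A in S) lyap k t.+1 (resample z o A) = lhs.
  apply: eq_bigr => A AS; have rS := resample_on o zS AS.
  have eX i : (i <= j)%N -> X (resample z o A) i = X z i.
    move=> ij; apply: X_ext => //; first exact: leq_trans ij (ltnW jM).
    move=> l li; rewrite ffunE; case: eqP => // lo.
    by move: li; rewrite lo /= ltnNge ij.
  have eK i : (i < j)%N -> KK (resample z o A) i = KK z i.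
    move=> ij; have iM := ltn_trans ij jM.
    rewrite -[i]/(val (Ordinal iM)) !KKE // ffunE; case: eqP => // e.
    by move: ij; rewrite -[i]/(val (Ordinal iM)) e ltnn.
  have [_ r] := run rS.
  have := r _ _ kN tq; rewrite /= -/j (eX j (leqnn j)) (eX _ kqj).
  rewrite (SdLBFGS_matrix_ext f p delta H0 eK eX).
  rewrite (KKE o rS) ffunE eqxx => E.
  by rewrite /lyap addnS -/j E eX.
apply: (le_trans h); rewrite ler_pM2l // /lyap -/j.
rewrite lerD2l lerN2; apply: ler_wpM2r (Gamma_le k tq).
exact: dot_ge0.
Qed.

Lemma expected_descent :
  Gamma * \sum_(z in ffun_on S) \sum_(k < N) \sum_(t < q) grad2 z (k * q + t)%N
  <= #|[pred z : {ffun 'I_M -> {set 'I_T}} | z \in ffun_on S]|%:R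
     * (F x0 - inf (range F)).
Proof.
pose E k := \sum_(z in ffun_on S) F (X z (k * q)%N).
have epoch k : (k < N)%N ->
    Gamma * \sum_(t < q) \sum_(z in ffun_on S) grad2 z (k * q + t)%N
    <= E k - E k.+1.
  move=> kN.
  (* At [t = 0] the iterate is the snapshot; at [t = q] the coefficient [c] is zero. Either way only
     [F] remains, so consecutive epochs share an endpoint. *)
  have E0 : E k = \sum_(z in ffun_on S) lyap k 0 z.
    apply: eq_bigr => z _; rewrite /lyap addn0 subrr.
    by rewrite -(scale0r (X z 0%N)) dotZr mul0r mulr0 addr0.
  have E1 : E k.+1 = \sum_(z in ffun_on S) lyap k q z.
    by apply: eq_bigr => z _; rewrite /lyap cq mul0r addr0 mulSn addnC.
  rewrite E0 E1 (telescope_ord (fun t => \sum_(z in ffun_on S) lyap k t z)).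
  by rewrite mulr_sumr; apply: ler_sum => t _; apply: expected_step.
rewrite exchange_big /=.
under eq_bigr do rewrite exchange_big /=.
have : Gamma * \sum_(k < N) \sum_(t < q) \sum_(z in ffun_on S) grad2 z (k * q + t)%N
    <= E 0%N - E N.
  by rewrite telescope_ord mulr_sumr; apply: ler_sum => k _; apply: epoch.
move/le_trans; apply.
rewrite /E -sumrB mulr_natl -sumr_const; apply: ler_sum => z zS.
rewrite mul0n; have [-> _] := run zS; rewrite lerD2l lerN2.
by have [_ lb _] := as1; apply: ge_inf => //; exists (X z (N * q)%N).
Qed.

End expected_descent.

(** * Step-size constants *)

Section constants.
Context {R : realType}.
Implicit Types (theta b L nu mu klow kbar : R) (m T q : nat).

(** Read backwards from [q], the recursion solves to a geometric sum with ratio [1 + theta], and [(1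
    + theta) ^+ q <= expR (q theta) <= expR 1]. *)
Lemma affine_recursion_bounds (c : nat -> R) theta b q :
  0 < theta -> 0 <= b -> q%:R * theta <= 1 -> c q = 0 ->
  (forall t, (t < q)%N -> c t = c t.+1 * (1 + theta) + b) ->
  forall t, (t <= q)%N -> 0 <= c t /\ theta * c t <= b * (expR 1 - 1).
Proof.
move=> th0 b0 qth cq rec.
have closed s : (s <= q)%N -> theta * c (q - s)%N = b * ((1 + theta) ^+ s - 1).
  elim: s => [|s IH] sq; first by rewrite subn0 cq expr0 subrr !mulr0.
  rewrite rec; last by rewrite -subSn // subSS leq_subr.
  have -> : (q - s.+1).+1 = (q - s)%N by rewrite subnSK.
  by rewrite mulrDr mulrA IH 1?ltnW // exprS; ring.
have th1 : 1 <= 1 + theta by rewrite lerDl ltW.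
move=> t tq; have := closed (q - t)%N (leq_subr _ _); rewrite subKn // => E.
have pow1 : 1 <= (1 + theta) ^+ (q - t) by rewrite exprn_ege1.
split; first by rewrite -(pmulr_rge0 _ th0) E mulr_ge0 // subr_ge0.
rewrite E ler_wpM2l // lerD2r.
apply: (@le_trans _ _ ((1 + theta) ^+ q)); first by rewrite ler_weXn2l ?leq_subr.
apply: (@le_trans _ _ (expR theta ^+ q)).
  by rewrite lerXn2r ?nnegrE ?expR_ge0 ?expR_ge1Dx // (le_trans ler01).
by rewrite -expRM_natl ler_expR.
Qed.

(** With the cube root [r] of [T] replacing fractional powers, the later identities are rational and
    fall to [field]. *)
Lemma powR_third T : (0 < T)%N -> exists r : R,
  [/\ 1 <= r, r ^+ 3 = T%:R, T%:R `^ (1 / 3) = r & T%:R `^ (2 / 3) = r ^+ 2].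
Proof.
move=> T0; have T1 : 1 <= T%:R :> R by rewrite ler1n.
have T0' : 0 <= T%:R :> R by rewrite ler0n.
exists (T%:R `^ (1 / 3)); split=> //.
- by rewrite -[leLHS](powRr0 T%:R) ler_powR // divr_ge0.
- by rewrite -powR_mulrn ?powR_ge0 // -powRrM divfK ?powRr1 // pnatr_eq0.
- rewrite -powR_mulrn ?powR_ge0 // -powRrM; congr (_ `^ _); ring.
Qed.

Section stepsize.
Variables (L nu mu klow kbar r : R) (m q : nat).
Hypotheses (L_gt0 : 0 < L) (klow_gt0 : 0 < klow) (kbar_gt0 : 0 < kbar).
Hypotheses (m_gt0 : (0 < m)%N) (mu_01 : 0 < mu < 1) (r_ge1 : 1 <= r).
Let alpha := mu * m%:R / (L * kbar * r ^+ 2).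
Let beta := L * kbar / r.
Let mr0 : 0 < m%:R :> R. Proof. by rewrite ltr0n. Qed.
Let mu0 : 0 < mu. Proof. by case/andP: mu_01. Qed.
Let r0 : 0 < r. Proof. exact: lt_le_trans r_ge1. Qed.
Let neqs : [/\ m%:R != 0 :> R, mu != 0, r != 0, L != 0 & kbar != 0].
Proof. by rewrite !gt_eqF. Qed.

Lemma coefficient_bounds (c : nat -> R) :
  q%:R <= r ^+ 3 / (3 * mu * m%:R) -> c q = 0 ->
  (forall t, (t < q)%N ->
     c t = c t.+1 * (1 + alpha * beta
             + 2 * L ^+ 2 * alpha ^+ 2 * kbar ^+ 2 / m%:R)
           + alpha ^+ 2 * L ^+ 3 * kbar ^+ 2 / m%:R) ->
  forall t, (t <= q)%N -> 0 <= c t <= mu * L * (expR 1 - 1) / r.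
Proof.
move=> hq cq rec t tq; have [? ? ? ? ?] := neqs.
(* For the chosen step sizes, [theta] is [alpha beta + 2 L^2 alpha^2 kbar^2 / m] and the constant
   term [b] is [alpha^2 L^3 kbar^2 / m]. *)
pose theta := mu * m%:R / r ^+ 3 + 2 * mu ^+ 2 * m%:R / r ^+ 4.
pose b := mu ^+ 2 * m%:R * L / r ^+ 4.
have th0 : 0 < theta.
  by rewrite addr_gt0 ?divr_gt0 ?mulr_gt0 ?exprn_gt0.
have b0 : 0 < b by rewrite divr_gt0 ?mulr_gt0 ?exprn_gt0.
(* Since [mu / r <= 1], [theta] is at most three times its first term; this 3 matches the one in the
   epoch length and gives [q theta <= 1]. *)
have th_le : theta <= 3 * mu * m%:R / r ^+ 3.
  have -> : theta = mu * m%:R / r ^+ 3 * (1 + 2 * (mu / r)).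
    by rewrite /theta; field.
  have -> : 3 * mu * m%:R / r ^+ 3 = mu * m%:R / r ^+ 3 * (1 + 2 * 1).
    by field.
  rewrite ler_pM2l ?divr_gt0 ?mulr_gt0 ?exprn_gt0 // lerD2l ler_pM2l //.
  by rewrite ler_pdivrMr // mul1r (le_trans _ r_ge1) //; case/andP: mu_01 => _ /ltW.
have qth : q%:R * theta <= 1.
  apply: (@le_trans _ _ (r ^+ 3 / (3 * mu * m%:R) * (3 * mu * m%:R / r ^+ 3))).
    by apply: ler_pM => //; rewrite ltW.
  by rewrite le_eqVlt; apply/orP; left; apply/eqP; field; apply/and3P; split.
have rec' s : (s < q)%N -> c s = c s.+1 * (1 + theta) + b.
  by move=> sq; rewrite rec // /theta /b /alpha /beta; field; do ?[apply/andP; split].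
have [-> h] := affine_recursion_bounds th0 (ltW b0) qth cq rec' tq.
rewrite /= -(ler_pM2l th0); apply: (le_trans h).
have e1 : 0 <= expR 1 - 1 :> R by rewrite subr_ge0 -{1}expR0 ler_expR.
have -> : theta * (mu * L * (expR 1 - 1) / r)
   = b * (expR 1 - 1) + 2 * mu ^+ 3 * m%:R * L / r ^+ 5 * (expR 1 - 1).
  by rewrite /theta /b; field.
by rewrite lerDl mulr_ge0 // ltW // divr_gt0 ?mulr_gt0 ?exprn_gt0.
Qed.

(** After division by [alpha], each of the three losses is at most one term of the condition, which
    is free of [r]. *)
Lemma descent_rate_ge c : 0 <= c <= mu * L * (expR 1 - 1) / r ->
  mu * kbar * (expR 1 - 1) + mu * m%:R * kbar
    + 2 * mu ^+ 2 * kbar * m%:R * (expR 1 - 1)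
  <= (1 - nu * kbar / (mu * klow)) * klow ->
  nu * m%:R / (L * r ^+ 2)
  <= alpha * klow - c * alpha * kbar ^+ 2 / beta - alpha ^+ 2 * L * kbar ^+ 2
     - 2 * c * alpha ^+ 2 * kbar ^+ 2.
Proof.
move=> /andP[c0 cle] cond; have [? ? ? ? ?] := neqs.
have kl0 : klow != 0 by rewrite gt_eqF.
have a0 : 0 < alpha by rewrite divr_gt0 ?mulr_gt0 ?exprn_gt0.
have -> : nu * m%:R / (L * r ^+ 2) = alpha * (nu * kbar / mu).
  by rewrite /alpha; field; do ?[apply/andP; split].
have -> : alpha * klow - c * alpha * kbar ^+ 2 / beta - alpha ^+ 2 * L * kbar ^+ 2
     - 2 * c * alpha ^+ 2 * kbar ^+ 2
   = alpha * (klow - c * (kbar * r / L) - mu * m%:R * kbar / r ^+ 2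
              - 2 * c * (mu * m%:R * kbar / (L * r ^+ 2))).
  by rewrite /alpha /beta; field; do ?[apply/andP; split].
rewrite ler_pM2l //.
have e1 : 0 <= expR 1 - 1 :> R by rewrite subr_ge0 -{1}expR0 ler_expR.
have ri (k : nat) : (r ^+ k)^-1 <= 1.
  by rewrite invf_le1 ?exprn_gt0 // exprn_ege1.
(* The [1 / r] in the bound on [c] cancels the [r] from [1 / beta]; the other two losses keep
   factors [r^-2] and [r^-3], at most 1. *)
have h1 : c * (kbar * r / L) <= mu * kbar * (expR 1 - 1).
  have -> : mu * kbar * (expR 1 - 1)
     = mu * L * (expR 1 - 1) / r * (kbar * r / L) by field; apply/andP.
  by apply: ler_wpM2r cle; rewrite divr_ge0 ?mulr_ge0 // ltW.
have h2 : mu * m%:R * kbar / r ^+ 2 <= mu * m%:R * kbar.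
  by rewrite ler_piMr // !mulr_ge0 // ltW.
have h3 : 2 * c * (mu * m%:R * kbar / (L * r ^+ 2))
    <= 2 * mu ^+ 2 * kbar * m%:R * (expR 1 - 1).
  apply: (@le_trans _ _ (2 * (mu * L * (expR 1 - 1) / r)
                         * (mu * m%:R * kbar / (L * r ^+ 2)))).
    apply: ler_wpM2r; first by rewrite divr_ge0 ?mulr_ge0 ?exprn_ge0 // ltW.
    by rewrite ler_pM2l.
  have -> : 2 * (mu * L * (expR 1 - 1) / r) * (mu * m%:R * kbar / (L * r ^+ 2))
     = 2 * mu ^+ 2 * kbar * m%:R * (expR 1 - 1) * (r ^+ 3)^-1.
    by field; apply/andP.
  by rewrite ler_piMr // !mulr_ge0 ?sqr_ge0 // ltW.
have h4 : (1 - nu * kbar / (mu * klow)) * klow = klow - nu * kbar / mu.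
  by field; apply/andP.
rewrite h4 in cond; lra.
Qed.

End stepsize.
End constants.

(** * From histories to the probability space *)

Section finite_expectation.
Context d (Om : measurableType d) (R : realType) (P : probability Om R).

Lemma probability_nonempty : [set: Om] !=set0.
Proof.
apply/set0P/eqP => e; have := @probability_setT _ _ _ P.
by rewrite e measure0 => /eqP; rewrite eq_sym onee_eq0.
Qed.

(** [Y] is a finite combination of indicators of the measurable fibres of [Z], so its integral is a
    finite weighted sum. *)
Lemma expectation_finite_le (I : finType) (Z : Om -> I) (Y : Om -> R)
    (h w : I -> R) (e : R) :
  (forall i, measurable (Z @^-1` [set i])) ->
  (forall i, P (Z @^-1` [set i]) = (w i)%:E) ->
  (forall om, Y om = h (Z om)) -> (forall i, 0 <= h i) ->
  \sum_i h i * w i <= e -> ('E_P[Y] <= e%:E)%E.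
Proof.
move=> mZ PZ YE h0 he; rewrite unlock.
have E om : (Y om)%:E = (\sum_(i : I) (h i)%:E * (\1_(Z @^-1` [set i]) om)%:E)%E.
  rewrite (bigD1 (Z om)) //= big1 => [|i iZ].
    by rewrite indicE mem_set // mule1 adde0 YE.
  by rewrite indicE memNset ?mule0 //= => /esym/eqP; rewrite (negPf iZ).
under eq_integral do rewrite E.
rewrite ge0_integral_sum //=; last 2 first.
- move=> i; apply: measurable_funeM; apply/measurable_EFinP.
  exact: measurable_indic.
- by move=> i om _; rewrite mule_ge0 // lee_fin.
rewrite (eq_bigr (fun i => (h i * w i)%:E)) => [|i _].
  by rewrite sumEFin lee_fin.
rewrite ge0_integralZl ?lee_fin //=.
  by rewrite integral_indic // setIT EFinM -PZ.
by apply/measurable_EFinP; exact: measurable_indic.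
Qed.

Context (V W : finType) (M : nat) (K : Om -> nat -> V) (J : Om -> W).

Lemma measurable_joint (z : {ffun 'I_M -> V}) (y : W) :
  (forall (j : 'I_M) v, measurable ((K^~ j) @^-1` [set v])) ->
  (forall v, measurable (J @^-1` [set v])) ->
  measurable [set om | (forall j : 'I_M, K om j = z j) /\ J om = y].
Proof.
move=> mK mJ.
have -> : [set om | (forall j : 'I_M, K om j = z j) /\ J om = y]
   = (\bigcap_(j in [set: 'I_M]) ((K^~ j) @^-1` [set z j])) `&` (J @^-1` [set y]).
  apply/seteqP; split=> om [h1 h2]; split => // j; first by move=> _; exact: h1.
  exact: (h1 j I).
apply: measurableI => //; apply: fin_bigcap_measurable => // j _; exact: mK.
Qed.

(** Independence on singletons factors the probability; an entry of [z] outside [S] contributes a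
    zero factor. *)
Lemma probability_joint (S : {pred V}) (z : {ffun 'I_M -> V}) (y : W) :
  (forall j, (j < M)%N -> uniform_on P S (K^~ j)) -> uniform_on P predT J ->
  mutually_independent P M K J ->
  P [set om | (forall j : 'I_M, K om j = z j) /\ J om = y]
  = (if z \in ffun_on S then (#|S|%:R ^+ M)^-1 * #|W|%:R^-1 else 0)%:E.
Proof.
move=> uK uJ ind; rewrite (ind (fun j => [set z j]) [set y]).
rewrite [P _](proj2 (uJ y)) /=.
rewrite (eq_bigr (fun j : 'I_M => (if z j \in S then #|S|%:R^-1 else 0)%:E))
  => [|j _]; last by have [_ <-] := uK j (ltn_ord j) (z j).
rewrite prodEFin -EFinM; congr (_%:E); case: ifPn => zS.
  rewrite (eq_bigr (fun=> #|S|%:R^-1)) => [|j _]; last by move/ffun_onP: zS => ->.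
  by rewrite prodr_const card_ord exprVn.
have [j zj] : exists j, z j \notin S.
  by apply/existsP; rewrite -negb_forall; apply: contra zS => /forallP; move/ffun_onP.
by rewrite (bigD1 j) //= (negPf zj) !mul0r.
Qed.

End finite_expectation.

(** The pair of sample history and output index is uniform on a finite set, so the expectation
    becomes the counting average bounded by [expected_descent]. The last hypothesis asks that [N q]
    be large enough, with denominators cleared. *)
Lemma expected_gradient_bound (R : realType) (L nu mu0 klow kbar sigma delta : R)
    (m T q N n p : nat) (f : 'I_T -> 'cV[R]_n -> R)
    (x0 : 'cV[R]_n) (H0 : 'M[R]_n)
    (alpha : nat -> nat -> R) (beta : nat -> R) (c : nat -> nat -> R)
    (d : measure_display) (Om : measurableType d) (P : probability Om R)
    (K : Om -> nat -> {set 'I_T}) (x : Om -> nat -> 'cV[R]_n)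
    (J : Om -> 'I_N * 'I_q) (eps : R) :
  0 < L -> 0 < klow -> 0 < kbar -> (0 < m)%N -> 0 < nu -> 0 < mu0 < 1 ->
  mu0 * kbar * (expR 1 - 1) + mu0 * m%:R * kbar
    + 2 * mu0 ^+ 2 * kbar * m%:R * (expR 1 - 1)
  <= (1 - nu * kbar / (mu0 * klow)) * klow ->
  (m <= T)%N -> q%:R <= T%:R / (3 * mu0 * m%:R) ->
  AS1 f L ->
  (forall w (j : nat), (j <= N * q)%N -> AS2_at f sigma (x w j)) ->
  sample_smooth f L ->
  (forall t, beta t = L * kbar / T%:R `^ (1 / 3)) ->
  (forall k t, alpha k t = mu0 * m%:R / (L * kbar * T%:R `^ (2 / 3))) ->
  (forall k, c k q = 0) ->
  (forall k t, (t < q)%N ->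
     c k t = c k t.+1 * (1 + alpha k t * beta t
               + 2 * L ^+ 2 * alpha k t ^+ 2 * kbar ^+ 2 / m%:R)
             + alpha k t ^+ 2 * L ^+ 3 * kbar ^+ 2 / m%:R) ->
  (forall j : nat, (j < N * q)%N ->
     uniform_on P [pred A : {set 'I_T} | #|A| == m] (fun w => K w j)) ->
  uniform_on P predT J ->
  mutually_independent P (N * q) K J ->
  (forall w, SdLBFGS_VR_run f p delta H0 (K w) (x w) x0 alpha q N) ->
  (forall w (j : nat), (j < N * q)%N ->
     loewner_le klow%:M (SdLBFGS_matrix f p delta H0 (K w) (x w) j) /\
     loewner_le (SdLBFGS_matrix f p delta H0 (K w) (x w) j) kbar%:M) ->
  (objective f x0 - inf (range (objective f))) * (L * T%:R `^ (2 / 3))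
    <= eps * (nu * m%:R * (N * q)%:R) ->
  ('E_P[fun w => (enorm (gradient (objective f)
           (x w ((J w).1 * q + (J w).2)%N)) ^+ 2)%R] <= eps%:E)%E.
Proof.
move=> L0 klow0 kbar0 m0 nu0 mu01 cond mT hq as1 as2 smooth betaE alphaE cq crec
  uK uJ ind run bounds heps.
have T0 : (0 < T)%N by rewrite (leq_trans m0).
have [r [r1 r3 r13 r23]] := @powR_third R T T0.
have r_gt0 : 0 < r by apply: lt_le_trans r1.
rewrite r23 in alphaE heps; rewrite r13 in betaE; rewrite -r3 in hq.
pose al := mu0 * m%:R / (L * kbar * r ^+ 2); pose be := L * kbar / r.
have eal : alpha = (fun _ _ => al) by apply/funext => k; apply/funext => t.
rewrite {}eal in crec run.
have {}crec k t : (t < q)%N -> c k t = c k t.+1 * (1 + al * be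
    + 2 * L ^+ 2 * al ^+ 2 * kbar ^+ 2 / m%:R)
    + al ^+ 2 * L ^+ 3 * kbar ^+ 2 / m%:R.
  by move=> tq; rewrite crec // betaE.
have cb k t : (t <= q)%N -> 0 <= c k t <= mu0 * L * (expR 1 - 1) / r.
  exact: (coefficient_bounds L0 kbar0 m0 mu01 r1 hq (cq k) (crec k)).
have m_gt0 : 0 < m%:R :> R by rewrite ltr0n.
pose S : pred {set 'I_T} := [pred A : {set 'I_T} | #|A| == m].
pose M := (N * q)%N.
pose Gamma := nu * m%:R / (L * r ^+ 2).
have [w0 _] := probability_nonempty P.
have N0 : (0 < N)%N by case: (J w0).1 => k; apply: leq_ltn_trans.
have q0 : (0 < q)%N by case: (J w0).2 => k; apply: leq_ltn_trans.
pose history w : {ffun 'I_M -> {set 'I_T}} := [ffun j : 'I_M => K w j].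
(* A sample point realising the history [z], with default [w0], turns runs indexed by sample points
   into runs indexed by histories. *)
pose rep z := xget w0 [set w | history w = z].
have repE w : history (rep (history w)) = history w.
  by apply: (@xgetI _ w0 [set w' | history w' = history w] w).
have s0 : 0 < #|S|%:R :> R by apply: card_subsets_gt0.
have y0 := J w0.
have jointE (z : {ffun 'I_M -> {set 'I_T}}) y : [set w | (forall j : 'I_M, K w j = z j) /\ J w = y]
    = (fun w => (history w, J w)) @^-1` [set (z, y)].
  apply/seteqP; split=> w /=.
    by move=> [h ->]; congr pair; apply/ffunP => j; rewrite ffunE.
  by case=> <- <-; split => // j; rewrite ffunE.
have card_W : #|{: 'I_N * 'I_q}| = M by rewrite card_prod !card_ord.
have M0 : 0 < M%:R :> R by rewrite ltr0n muln_gt0 N0.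
(* Every history of m-subsets has positive probability, hence is realised by some sample point. *)
have repS z : z \in ffun_on S -> history (rep z) = z.
  move=> zS; have [w hw] : exists w, history w = z.
    apply: contrapT => /forallNP none.
    have := probability_joint z y0 uK uJ ind.
    rewrite zS card_W.
    suff -> : [set w | (forall j : 'I_M, K w j = z j) /\ J w = y0] = set0.
      rewrite measure0 => -[] /esym/eqP.
      by rewrite gt_eqF // mulr_gt0 // invr_gt0 ?exprn_gt0.
    apply/seteqP; split=> // w [h _]; apply: (none w).
    by apply/ffunP => j; rewrite ffunE.
  by rewrite -hw repE.
have xE w j : (j <= M)%N -> x w j = x (rep (history w)) j.
  move=> jM; apply: (SdLBFGS_VR_run_ext (run _) (run _) jM) => i ij.
  have /ffunP/(_ (Ordinal (leq_trans ij jM))) := repE w.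
  by rewrite !ffunE.
pose F := objective f.
pose g z j := dot (gradient F (x (rep z) j)) (gradient F (x (rep z) j)).
have Gamma0 : 0 < Gamma.
  by rewrite /Gamma divr_gt0 ?mulr_gt0 // exprn_gt0.
have main := @expected_descent R T n f m p q N L sigma klow kbar al be delta Gamma
  H0 x0 c (fun z => K (rep z)) (fun z => x (rep z)).
have {}main : Gamma * \sum_(z in ffun_on S) \sum_(k < N) \sum_(t < q) g z (k * q + t)%N
  <= #|[pred z : {ffun 'I_M -> {set 'I_T}} | z \in ffun_on S]|%:R
     * (F x0 - inf (range F)).
  apply: main => //.
  - by rewrite divr_ge0 ?mulr_ge0 ?exprn_ge0 // ltW //; case/andP: mu01.
  - by rewrite divr_gt0 ?mulr_gt0.
  - by move=> z i /repS/ffunP/(_ i); rewrite ffunE.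
  - by move=> z j _; apply: as2.
  - by move=> z j _; apply: bounds.
  - by move=> k t tq; case/andP: (cb k t.+1 tq).
  - by move=> k t tq; apply: descent_rate_ge (cb k t.+1 tq) cond.
pose h (i : {ffun 'I_M -> {set 'I_T}} * ('I_N * 'I_q)) := g i.1 (i.2.1 * q + i.2.2)%N.
pose wt (i : {ffun 'I_M -> {set 'I_T}} * ('I_N * 'I_q)) : R :=
  if i.1 \in ffun_on S then (#|S|%:R ^+ M)^-1 * #|{: 'I_N * 'I_q}|%:R^-1 else 0.
apply: (@expectation_finite_le _ _ _ P _ (fun w => (history w, J w)) _ h wt).
- move=> [z y]; rewrite -jointE; apply: measurable_joint => [j v|v].
    by have [] := uK j (ltn_ord j) v.
  by have [] := uJ v.
- by move=> [z y]; rewrite -jointE; apply: probability_joint.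
- move=> w; rewrite enorm_sqr /h /g /= -xE //.
  apply: (@leq_trans ((J w).1.+1 * q)).
    by rewrite mulSn addnC leq_add2r ltnW.
  by rewrite leq_mul2r ltn_ord orbT.
- by move=> i; apply: dot_ge0.
have -> : \sum_i h i * wt i = (#|S|%:R ^+ M)^-1 * M%:R^-1 *
    \sum_(z in ffun_on S) \sum_(k < N) \sum_(t < q) g z (k * q + t)%N.
  rewrite -(pair_bigA _ (fun z y => h (z, y) * wt (z, y))) /=.
  rewrite mulr_sumr [RHS]big_mkcond /=; apply: eq_bigr => z _.
  rewrite /wt /= card_W; case: ifP => _; last by rewrite big1 // => y _; rewrite mulr0.
  rewrite -mulr_suml mulrC; congr (_ * _).
  by rewrite pair_bigA.
have cardS : #|[pred z : {ffun 'I_M -> {set 'I_T}} | z \in ffun_on S]|%:R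
    = #|S|%:R ^+ M :> R.
  by rewrite -natrX -[in RHS](card_ord M) -card_ffun_on; congr (_%:R); apply: eq_card.
rewrite cardS in main; set E := \sum_(z in _) _ in main *.
have sM : 0 < #|S|%:R ^+ M :> R by rewrite exprn_gt0.
rewrite -invfM mulrC ler_pdivrMr ?mulr_gt0 // -(ler_pM2l Gamma0).
apply: (le_trans main).
have -> : Gamma * (eps * (#|S|%:R ^+ M * M%:R))
    = #|S|%:R ^+ M * (Gamma * eps * M%:R) by ring.
have Lr0 : 0 < L * r ^+ 2 by rewrite mulr_gt0 // exprn_gt0.
rewrite ler_pM2l // -(ler_pM2r Lr0); apply: (le_trans heps).
rewrite le_eqVlt; apply/orP; left; apply/eqP.
by rewrite /Gamma -/M; field; rewrite !gt_eqF.
Qed.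

(** [C] is chosen before [T], [q] and [eps]. The case [N0 = 1] is separate because a single epoch
    already costs at least [T] evaluations, which exceeds [C T^(2/3) / eps] once
    [eps > C T^(-1/3)]. *)
Theorem corollary4p2 (R : realType)
    (L nu mu0 klow kbar gap : R) (m a : nat)
    (hL : 0 < L) (hklow : 0 < klow) (hkbar : 0 < kbar) (hm : (0 < m)%N)
    (hnu : 0 < nu < 1) (hmu0 : 0 < mu0 < 1)
    (hcond : mu0 * kbar * (expR 1 - 1) + mu0 * m%:R * kbar
               + 2 * mu0 ^+ 2 * kbar * m%:R * (expR 1 - 1)
             <= (1 - nu * kbar / (mu0 * klow)) * klow) :
  exists C : R, 0 < C /\
  forall (T q : nat) (eps : R),
    (m <= T)%N ->
    Posz q = Num.floor (T%:R / (3 * mu0 * m%:R) : R) ->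
    0 < eps ->
  exists N0 : nat,
    [/\ (0 < N0)%N,
        N0 = 1%N \/
        (component_evals T m a q N0)%:R <= C * (T%:R `^ (2 / 3) / eps)
      & forall (N n : nat) (f : 'I_T -> 'cV[R]_n -> R)
          (sigma kappa delta : R) (p : nat) (x0 : 'cV[R]_n) (H0 : 'M[R]_n)
          (alpha : nat -> nat -> R) (beta : nat -> R) (c : nat -> nat -> R)
          (d : measure_display) (Om : measurableType d) (P : probability Om R)
          (K : Om -> nat -> {set 'I_T}) (x : Om -> nat -> 'cV[R]_n)
          (J : Om -> 'I_N * 'I_q),
        (N0 <= N)%N ->
        AS1 f L ->
        (forall w (j : nat), (j <= N * q)%N -> AS2_at f sigma (x w j)) ->
        AS5 f kappa ->
        sample_smooth f L ->
        objective f x0 - inf (range (objective f)) = gap ->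
        0 < delta ->
        (forall t, beta t = L * kbar / T%:R `^ (1 / 3)) ->
        (forall k t, alpha k t = mu0 * m%:R / (L * kbar * T%:R `^ (2 / 3))) ->
        (forall k, c k q = 0) ->
        (forall k t, (t < q)%N ->
           c k t = c k t.+1 * (1 + alpha k t * beta t
                     + 2 * L ^+ 2 * alpha k t ^+ 2 * kbar ^+ 2 / m%:R)
                   + alpha k t ^+ 2 * L ^+ 3 * kbar ^+ 2 / m%:R) ->
        (forall j : nat, (j < N * q)%N ->
           uniform_on P [pred A : {set 'I_T} | #|A| == m] (fun w => K w j)) ->
        uniform_on P predT J ->
        mutually_independent P (N * q) K J ->
        (forall w,
           SdLBFGS_VR_run f p delta H0 (K w) (x w) x0 alpha q N) ->
        (forall w (j : nat), (j < N * q)%N ->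
           loewner_le klow%:M (SdLBFGS_matrix f p delta H0 (K w) (x w) j) /\
           loewner_le (SdLBFGS_matrix f p delta H0 (K w) (x w) j) kbar%:M) ->
        ('E_P[fun w => (enorm (gradient (objective f)
                 (x w ((J w).1 * q + (J w).2)%N)) ^+ 2)%R] <= eps%:E)%E].

Proof.
have [nu0 _] := andP hnu; have [mu_gt0 mu_lt1] := andP hmu0.
have m_gt0 : 0 < m%:R :> R by rewrite ltr0n.
have num0 : 0 < nu * m%:R by rewrite mulr_gt0.
(* The epoch cost bound [(6 mu0 m + a m) q] times the bound [2 B] on the number of epochs, with
   [T^(2/3) / eps] taken out; the factors [q] cancel. *)
pose C0 := (6 * mu0 * m%:R + (a * m)%:R) * (2 * `|gap| * L / (nu * m%:R)).
have C0_ge0 : 0 <= C0.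
  apply: mulr_ge0; first by rewrite addr_ge0 ?ler0n ?mulr_ge0 // ltW.
  by rewrite divr_ge0 ?mulr_ge0 ?normr_ge0 // ltW.
(* One is added because [C0] vanishes when [gap = 0]. *)
exists (C0 + 1); split; first by rewrite ltr_wpDl.
move=> T q eps mT qE eps0.
have T0 : 0 < T%:R :> R by rewrite ltr0n (leq_trans hm).
have P0 : 0 < T%:R `^ (2 / 3) :> R by rewrite powR_gt0.
have [q_le q_gt] : q%:R <= T%:R / (3 * mu0 * m%:R)
    /\ T%:R / (3 * mu0 * m%:R) < q%:R + 1.
  have := floor_itv (T%:R / (3 * mu0 * m%:R)).
  by rewrite -qE intrD -pmulrn => /andP[].
(* The number of epochs at which the bound on the mean squared gradient reaches [eps]; the absolute
   value is there because [gap] is an arbitrary real at this point. *)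
pose B := `|gap| * L * T%:R `^ (2 / 3) / (eps * (nu * m%:R) * q%:R).
have B0 : 0 <= B.
  by rewrite divr_ge0 ?mulr_ge0 ?normr_ge0 ?ler0n // ltW.
have [B_ge B_lt] := andP (trunc_itv B0).
exists (Num.trunc B).+1; split=> //.
- case: (posnP (Num.trunc B)) => [->|tB]; [by left|right].
  (* For [q = 0] the inverse of zero is zero, so [B = 0], against [trunc B > 0]. *)
  have q0 : 0 < q%:R :> R.
    rewrite ltr0n lt0n; apply: contraTneq tB => q0.
    by rewrite /B q0 mulr0 invr0 mulr0 trunc0.
  have N_le : (Num.trunc B).+1%:R <= 2 * B.
    have : 1 <= (Num.trunc B)%:R :> R by rewrite ler1n.
    by rewrite -natr1; lra.
  have q1 : 1 <= q%:R :> R by rewrite ler1n -(ltr0n R).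
  (* From [T < 3 mu0 m (q + 1)] and [q + 1 <= 2 q]. *)
  have T_le : T%:R <= 6 * mu0 * m%:R * q%:R.
    move: q_gt; rewrite ltr_pdivrMr ?mulr_gt0 // => /ltW/le_trans; apply.
    have : mu0 * m%:R <= mu0 * m%:R * q%:R by rewrite ler_peMr // ltW ?mulr_gt0.
    lra.
  rewrite /component_evals natrM.
  apply: (@le_trans _ _ ((6 * mu0 * m%:R + (a * m)%:R) * q%:R * (2 * B))).
    apply: ler_pM => //; rewrite natrD natrM mulrDl; apply: lerD => //.
    by rewrite mulrC.
  apply: (@le_trans _ _ (C0 * (T%:R `^ (2 / 3) / eps))).
    rewrite le_eqVlt; apply/orP; left; apply/eqP.
    by rewrite /C0 /B; field; rewrite !gt_eqF.
  by rewrite ler_wpM2r ?lerDl // divr_ge0 // ltW.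
- move=> N n f sigma kappa delta p x0 H0 alpha beta c d Om P K x J N0N.
  move=> as1 as2 _ smooth gapE _ betaE alphaE cq crec uK uJ ind run bounds.
  apply: (expected_gradient_bound hL hklow hkbar hm nu0 hmu0 hcond mT q_le as1 as2
    smooth betaE alphaE cq crec uK uJ ind run bounds).
  (* The output index of a sample point forces [q > 0], so [B <= N] can be cleared of its
     denominator. *)
  have [w0 _] := probability_nonempty P.
  have q0 : 0 < q%:R :> R.
    by rewrite ltr0n; case: (J w0).2 => k; apply: leq_ltn_trans.
  have B_le : B <= N%:R.
    by apply: (le_trans (ltW B_lt)); rewrite ler_nat.
  rewrite gapE; apply: (@le_trans _ _ (`|gap| * (L * T%:R `^ (2 / 3)))).
    by rewrite ler_wpM2r ?ler_norm // mulr_ge0 // ltW.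
  move: B_le; rewrite ler_pdivrMr ?mulr_gt0 // natrM; lra.
Qed.
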